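(* Let $r\ge0$ be an integer and write the $r$-th Legendre polynomial as $P_r(x)=\sum_{i\in S_r}a_ix^i$. Then $$P_r(x)^2=\sum_{i\in S_r}a_i\left(\sqrt{2x^2-1}\right)^iP_i\left(\frac{x^2}{\sqrt{2x^2-1}}\right).$$
   Context: The Legendre polynomials are defined by $P_0(x)=1$, $P_1(x)=x$, $(r+1)P_{r+1}(x)=(2r+1)xP_r(x)-rP_{r-1}(x)$. For an integer $k\ge0$, $S_k=\{0,2,\dots,k\}$ if $k$ is even and $S_k=\{1,3,\dots,k\}$ if $k$ is odd; $P_r$ only has terms of degree in $S_r$. The identity is in characteristic zero. Since $P_i$ is even or odd according to the parity of $i$, the expression $(\sqrt{2x^2-1})^iP_i(x^2/\sqrt{2x^2-1})$ is a polynomial in $x$, independent of the choice of the square root. *)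

(* Defs.v *)
From HB Require Import structures.
From mathcomp Require Import all_boot all_order all_algebra.

Set Implicit Arguments.
Unset Strict Implicit.
Unset Printing Implicit Defensive.

Import GRing.Theory.
Local Open Scope ring_scope.

(* The recurrence is solved for its leading term, so [legendre F] is the      *)
(* Legendre family only when [F] has characteristic zero (see [legendreSS]).  *)
Fixpoint legendre (F : fieldType) (n : nat) : {poly F} :=
  match n with
  | 0 => 1
  | r.+1 =>
    match r with
    | 0 => 'X
    | q.+1 => (r.+1)%:R^-1 *:
        ((2 * r + 1)%:R *: ('X * legendre F r) - r%:R *: legendre F q)
    end
  end.

Lemma legendreSS (F : fieldType) (charF0 : [pchar F] =i pred0) (q : nat) :
  q.+2%:R *: legendre F q.+2 =
  (2 * q.+1 + 1)%:R *: ('X * legendre F q.+1) - q.+1%:R *: legendre F q.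
Proof.
have nz : q.+2%:R != 0 :> F by move/pcharf0P: charF0 => ->.
by rewrite [legendre F q.+2]/= scalerA divff // scale1r.
Qed.

(* The polynomial [T] over [F] is the expression                              *)
(*   (sqrt (2 x^2 - 1))^i P_i (x^2 / sqrt (2 x^2 - 1)).                       *)
(* The square root [s] is either root, in any field [L] containing [F]. The   *)
(* condition [s != 0] only makes the quotient meaningful. As [L] may be an    *)
(* algebraic closure of F(x), with [x] the indeterminate, at most one [T]     *)
(* satisfies this.                                                            *)
Definition is_sqrt_legendre (F : fieldType) (i : nat) (T : {poly F}) : Prop :=
  forall (L : fieldType) (f : {rmorphism F -> L}) (x s : L),
    s ^+ 2 = 2%:R * x ^+ 2 - 1 -> s != 0 ->
    (map_poly f T).[x] = s ^+ i * (map_poly f (legendre F i)).[x ^+ 2 / s].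

(* Main.v *)
Require Import Defs.
From mathcomp Require Import all_boot all_order all_algebra.
From mathcomp Require Import ring.

Import GRing.Theory.
Local Open Scope ring_scope.

(** Write T_i for the polynomial s^i P_i(x^2/s), where s^2 = 2x^2 - 1, and let
    M be the linear map on polynomials with M(y^i) = T_i.  The claim is
    M(P_r) = P_r^2.  Over the reals, since x^4 - s^2 = (1 - x^2)^2, Laplace's
    integral for P_i identifies M(q)(x) with the mean of
    q(x^2 + (1 - x^2) cos phi) over phi, and M(P_r) = P_r^2 is the addition
    theorem for two equal arguments.  The proof replaces the integral by
    differential equations.

    The square of a solution of Legendre's equation with eigenvalue l solves a
    third-order linear equation, the symmetric square of the first one
    ([sym2_op_sqr]).  The map M carries Legendre's operator to that third-order
    operator, up to a further operator on the source and a factor 4x on the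
    target ([sym2_op_circle_mean]), so M(P_r) solves the same equation as
    P_r^2.  The point 1 is a regular singular point of this equation with
    exponent 0 taken three times, so in characteristic zero a polynomial
    solution is determined by its value at 1 ([sym2_op_uniq]).  Both
    polynomials take the value 1 there.

    What is needed about M comes from the three-term recurrence of the T_i.  By
    linearity it becomes a relation between means of arbitrary polynomials
    ([circle_mean_rec]).  Recentred at y = 1, this relation makes
    M((y - 1)^k) a constant multiple of (x^2 - 1)^k, as the integral also
    shows, and hence it describes how M commutes with differentiation
    ([deriv_circle_mean]). *)

(** * Polynomials over a field *)

(** Linear identities are checked below on powers of X, where the recurrence of
    the T_i applies, and on powers of X - 1, which M sends to multiples of
    powers of X^2 - 1. *)
Lemma poly_lin_ind (F : fieldType) (c : F) (P : {poly F} -> Prop) :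
  P 0 -> (forall a p q, P p -> P q -> P (a%:P * p + q)) ->
  (forall k, P (('X - c%:P) ^+ k)) -> forall q, P q.
Proof.
move=> P0 PD PX q.
have -> : q = (q \Po ('X + c%:P)) \Po ('X - c%:P).
  by rewrite -comp_polyA comp_polyD comp_polyX comp_polyC subrK comp_polyXr.
rewrite [X in P X]comp_polyE.
elim: (index_enum _) => [|i s IH]; first by rewrite big_nil.
by rewrite big_cons -mul_polyC; apply: PD.
Qed.

Lemma pnatr_neq0 (F : fieldType) (charF0 : [pchar F] =i pred0) (n : nat) :
  n.+1%:R != 0 :> {poly F}.
Proof. by rewrite -polyC_natr polyC_eq0; move/pcharf0P: charF0 => ->. Qed.

Lemma deriv_natl (F : fieldType) (n : nat) (p : {poly F}) :
  (n%:R * p)^`() = n%:R * p^`().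
Proof. by rewrite !mulr_natl derivMn. Qed.

(** * Legendre polynomials *)

(** Rewriting with this equation unfolds the top index only, whereas
    simplification would also unfold the polynomial of index n + 1. *)
Lemma legendre_rec (F : fieldType) (n : nat) :
  legendre F n.+2 = n.+2%:R^-1 *:
    ((2 * n.+1 + 1)%:R *: ('X * legendre F n.+1) - n.+1%:R *: legendre F n).
Proof. by []. Qed.

Lemma natl_legendreSS (F : fieldType) (charF0 : [pchar F] =i pred0) (n : nat) :
  n.+2%:R * legendre F n.+2 =
  (2 * n.+1 + 1)%:R * ('X * legendre F n.+1) - n.+1%:R * legendre F n.
Proof.
by have := legendreSS charF0 n; rewrite -!mul_polyC !polyC_natr.
Qed.

Lemma size_legendre (F : fieldType) (n : nat) : (size (legendre F n) <= n.+1)%N.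
Proof.
elim/ltn_ind: n => -[|[|n]] IH; first by rewrite size_poly1.
  by rewrite size_polyX.
rewrite legendre_rec (leq_trans (size_scale_leq _ _)) //.
rewrite (leq_trans (size_polyD _ _)) // geq_max size_polyN.
rewrite !(leq_trans (size_scale_leq _ _)) //; last first.
  rewrite (leq_trans (size_polyMleq _ _)) // size_polyX.
  by apply: (IH n.+1).
by rewrite (leq_trans (IH n _)) //; apply: ltnW.
Qed.

Lemma legendre_coef_parity (F : fieldType) (n i : nat) :
  odd i != odd n -> (legendre F n)`_i = 0.
Proof.
elim/ltn_ind: n i => -[|[|n]] IH i.
- by rewrite coef1; case: i.
- by rewrite coefX; case: i => [|[|i]].
move=> par; rewrite legendre_rec coefZ coefB !coefZ coefXM.
rewrite [(legendre F n)`_i]IH //; last by move: par; rewrite /= negbK.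
case: i par => [|i] par; first by rewrite /= !mulr0 subr0 mulr0.
rewrite [_`_i.+1.-1](IH n.+1) ?mulr0 ?subr0 ?mulr0 //.
by move: par => /=; case: (odd i); case: (odd n).
Qed.

Lemma horner_legendre1 (F : fieldType) (charF0 : [pchar F] =i pred0) n :
  (legendre F n).[1] = 1.
Proof.
elim/ltn_ind: n => -[|[|n]] IH; [by rewrite hornerE | by rewrite hornerE |].
have nz : n.+2%:R != 0 :> F by move/pcharf0P: charF0 => ->.
rewrite legendre_rec !(hornerZ, hornerD, hornerN, hornerM).
rewrite !(hornerX, hornerC) !IH ?expr1n //.
by apply: (mulfI nz); rewrite mulVKf //; ring.
Qed.

(** These are proved together: the derivative of the recurrence and the second
    identity at n give the first one at n + 1, and then the recurrence itself
    with both identities at n gives the second one at n + 1. *)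
Lemma legendre_deriv (F : fieldType) (charF0 : [pchar F] =i pred0) (n : nat) :
  (legendre F n.+1)^`() = 'X * (legendre F n)^`() + n.+1%:R * legendre F n /\
  'X * (legendre F n.+1)^`() = (legendre F n)^`() + n.+1%:R * legendre F n.+1.
Proof.
elim: n => [|n [IHA IHB]]; first by rewrite /= derivX derivC; split; ring.
have rec := natl_legendreSS F charF0 n.
have nz := pnatr_neq0 F charF0 n.+1.
have drec := congr1 (@deriv F) rec.
rewrite derivB !deriv_natl derivM derivX in drec.
move: rec drec IHA IHB nz; set p2 := legendre F n.+2.
move: (legendre F n) (legendre F n.+1) p2 => p0 p1 p2.
move: (p0^`()) (p1^`()) (p2^`()) => d0 d1 d2 rec drec IHA IHB nz.
have A : d2 = 'X * d1 + n.+2%:R * p1.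
  apply: (mulfI nz); rewrite drec.
  have -> : d0 = 'X * d1 - n.+1%:R * p1 by rewrite IHB; ring.
  by ring.
split=> //; rewrite rec A mulrDr mulrA.
have -> : 'X * 'X * d1 = 'X * ('X * d1) by rewrite mulrA.
rewrite IHB.
have -> : 'X * (d0 + n.+1%:R * p1) = d1 - n.+1%:R * p0 + n.+1%:R * ('X * p1).
  by rewrite IHA; ring.
by ring.
Qed.

Lemma legendre_ode (F : fieldType) (charF0 : [pchar F] =i pred0) (n : nat) :
  (('X ^+ 2 - 1) * (legendre F n)^`())^`() = (n * n.+1)%:R * legendre F n.
Proof.
case: n => [|n]; first by rewrite /= derivC mulr0 derivC mul0r.
have [A B] := legendre_deriv F charF0 n.
have -> : ('X ^+ 2 - 1) * (legendre F n.+1)^`() =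
          n.+1%:R * ('X * legendre F n.+1 - legendre F n).
  rewrite mulrBl mul1r expr2 -mulrA B A; ring.
by rewrite deriv_natl derivB derivM derivX B; ring.
Qed.

(** * The polynomials s^i P_i(x^2/s) *)

(** Multiplying the Legendre recurrence at x^2/s by s^(n+1) turns the factor
    x^2/s into x^2 and the last term into one with s^2 = 2x^2 - 1, so no square
    root remains. *)
Fixpoint sqrt_legendre (F : fieldType) (n : nat) : {poly F} :=
  match n with
  | 0 => 1
  | r.+1 =>
    match r with
    | 0 => 'X ^+ 2
    | q.+1 => (r.+1)%:R^-1 *:
        ((2 * r + 1)%:R *: ('X ^+ 2 * sqrt_legendre F r)
         - r%:R *: ((2%:R *: 'X ^+ 2 - 1) * sqrt_legendre F q))
    end
  end.

Lemma sqrt_legendre_rec (F : fieldType) (n : nat) :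
  sqrt_legendre F n.+2 = n.+2%:R^-1 *:
    ((2 * n.+1 + 1)%:R *: ('X ^+ 2 * sqrt_legendre F n.+1)
     - n.+1%:R *: ((2%:R *: 'X ^+ 2 - 1) * sqrt_legendre F n)).
Proof. by []. Qed.

Lemma sqrt_legendreP (F : fieldType) (n : nat) :
  is_sqrt_legendre n (sqrt_legendre F n).
Proof.
move=> L f x s s2 s0; elim/ltn_ind: n => -[|[|n]] IH.
- by rewrite /= rmorph1 !hornerE.
- by rewrite /= rmorphXn /= map_polyX hornerXn hornerX; field.
rewrite sqrt_legendre_rec legendre_rec.
rewrite !(map_polyZ, rmorphB, rmorphM, rmorphXn, rmorph1) /= !map_polyZ.
rewrite !(rmorphB, rmorphM, rmorphXn, rmorph1) /= !map_polyZ.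
rewrite rmorphXn /= !map_polyX.
rewrite !(hornerZ, hornerD, hornerN, hornerM, hornerXn, hornerX, hornerC).
rewrite (IH n.+1) // (IH n) //.
rewrite !rmorph_nat -s2.
move: (_.[_]) (_.[_]) (f _) => u v c.
rewrite !exprS; field.
by [].
Qed.

Lemma natl_sqrt_legendreSS (F : fieldType) (charF0 : [pchar F] =i pred0) n :
  n.+2%:R * sqrt_legendre F n.+2 =
  (2 * n.+1 + 1)%:R * ('X ^+ 2 * sqrt_legendre F n.+1)
   - n.+1%:R * ((2%:R * 'X ^+ 2 - 1) * sqrt_legendre F n).
Proof.
have nz : n.+2%:R != 0 :> F by move/pcharf0P: charF0 => ->.
rewrite sqrt_legendre_rec -polyC_natr mul_polyC scalerA divff // scale1r.
by rewrite -!mul_polyC !polyC_natr.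
Qed.

Lemma horner_sqrt_legendre1 (F : fieldType) (charF0 : [pchar F] =i pred0) n :
  (sqrt_legendre F n).[1] = 1.
Proof.
elim/ltn_ind: n => -[|[|n]] IH;
  [by rewrite hornerE | by rewrite !hornerE expr1n |].
have nz : n.+2%:R != 0 :> F by move/pcharf0P: charF0 => ->.
rewrite sqrt_legendre_rec !(hornerZ, hornerD, hornerN, hornerM).
rewrite !(hornerX, hornerC) !IH ?expr1n //.
by apply: (mulfI nz); rewrite mulVKf //; ring.
Qed.

(** * The mean map *)

(** Over the reals this is the mean over phi of q(x^2 + (1 - x^2) cos phi), by
    Laplace's integral formula for the Legendre polynomials. *)
Definition circle_mean (F : fieldType) (q : {poly F}) : {poly F} :=
  \sum_(i < size q) q`_i *: sqrt_legendre F i.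

Lemma circle_mean_widen (F : fieldType) (q : {poly F}) n : (size q <= n)%N ->
  circle_mean F q = \sum_(i < n) q`_i *: sqrt_legendre F i.
Proof.
move=> le; rewrite /circle_mean.
rewrite (big_ord_widen _ (fun i => q`_i *: sqrt_legendre F i) le).
rewrite big_mkcond; apply: eq_bigr => i _; case: ltnP => // h.
by rewrite nth_default // scale0r.
Qed.

Lemma circle_meanD F p q :
  circle_mean F (p + q) = circle_mean F p + circle_mean F q.
Proof.
set n := maxn (size p) (size q).
rewrite !(@circle_mean_widen F _ n) ?leq_maxl ?leq_maxr ?size_polyD //.
rewrite -big_split /=.
by apply: eq_bigr => i _; rewrite coefD scalerDl.
Qed.

Lemma circle_meanC F c q : circle_mean F (c%:P * q) = c%:P * circle_mean F q.
Proof.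
rewrite !mul_polyC (@circle_mean_widen F _ (size q)) ?size_scale_leq //.
rewrite scaler_sumr.
by apply: eq_bigr => i _; rewrite coefZ scalerA.
Qed.

Lemma circle_mean_nat F n q : circle_mean F (n%:R * q) = n%:R * circle_mean F q.
Proof. by rewrite -polyC_natr circle_meanC. Qed.

Lemma circle_meanN F q : circle_mean F (- q) = - circle_mean F q.
Proof. by rewrite -mulN1r -polyCN circle_meanC polyCN mulN1r. Qed.

Lemma circle_mean0 F : circle_mean F 0 = 0.
Proof. by rewrite /circle_mean size_poly0 big_ord0. Qed.

Lemma circle_meanXn F n : circle_mean F ('X ^+ n) = sqrt_legendre F n.
Proof.
rewrite (@circle_mean_widen F _ n.+1) ?size_polyXn // (bigD1 ord_max) //=.
rewrite coefXn eqxx scale1r big1 ?addr0 // => i ne.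
by rewrite coefXn (_ : _ == _ = false) ?scale0r //; apply: negbTE.
Qed.

Lemma horner_circle_mean1 (F : fieldType) (charF0 : [pchar F] =i pred0) q :
  (circle_mean F q).[1] = q.[1].
Proof.
rewrite [RHS]horner_coef /circle_mean horner_sum; apply: eq_bigr => i _.
by rewrite hornerZ horner_sqrt_legendre1 // expr1n.
Qed.

(** For q = X^n this is the recurrence of [sqrt_legendre], because
    X^2 q' + X q, 2 X q' + q and q' are then (n + 1) X^(n+1), (2n + 1) X^n and
    n X^(n-1). *)
Lemma circle_mean_rec (F : fieldType) (charF0 : [pchar F] =i pred0) q :
  circle_mean F ('X ^+ 2 * q^`() + 'X * q) =
  'X ^+ 2 * circle_mean F (2%:R * ('X * q^`()) + q)
  - (2%:R * 'X ^+ 2 - 1) * circle_mean F q^`().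
Proof.
elim/(@poly_lin_ind F 0): q => [|a p q|k].
- by rewrite deriv0 !mulr0 !addr0 circle_mean0; ring.
- move=> IHp IHq.
  rewrite derivD derivM derivC mul0r add0r.
  have -> : 'X^2 * (a%:P * p^`() + q^`()) + 'X * (a%:P * p + q) =
    a%:P * ('X ^+ 2 * p^`() + 'X * p) + ('X ^+ 2 * q^`() + 'X * q) by ring.
  have -> : 2%:R * ('X * (a%:P * p^`() + q^`())) + (a%:P * p + q) =
    a%:P * (2%:R * ('X * p^`()) + p) + (2%:R * ('X * q^`()) + q) by ring.
  rewrite !(circle_meanD _ (_%:P * _)) !circle_meanC.
  by rewrite IHp IHq; ring.
rewrite subr0; case: k => [|k].
  rewrite expr0 derivC !mulr0 !add0r mulr1 circle_mean0.
  by rewrite -(expr0 'X) -{1}(expr1 'X) !circle_meanXn /=; ring.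
rewrite derivXn /= -mulr_natl.
have -> : ('X : {poly F}) ^+ 2 * (k.+1%:R * 'X ^+ k) + 'X * 'X ^+ k.+1 =
    k.+2%:R * 'X ^+ k.+2.
  by rewrite !exprS; ring.
have -> : 2%:R * (('X : {poly F}) * (k.+1%:R * 'X ^+ k)) + 'X ^+ k.+1 =
    (2 * k.+1 + 1)%:R * 'X ^+ k.+1.
  by rewrite !exprS; ring.
by rewrite !circle_mean_nat !circle_meanXn natl_sqrt_legendreSS //; ring.
Qed.

(** The previous relation recentred at 1: its terms combine because
    y^2 - 2 x^2 y + 2 x^2 - 1 = (y - 1) (y - 1 - 2 (x^2 - 1)). *)
Lemma circle_mean_rec1 (F : fieldType) (charF0 : [pchar F] =i pred0) q :
  circle_mean F (('X - 1) * (('X - 1) * q)^`()) =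
  ('X ^+ 2 - 1) * circle_mean F (2%:R * (('X - 1) * q^`()) + q).
Proof.
have rel := circle_mean_rec F charF0 q.
have -> : ('X - 1) * (('X - 1) * q)^`() =
   ('X ^+ 2 * q^`() + 'X * q) - (2%:R * ('X * q^`()) + q) + q^`().
  by rewrite derivM derivB derivX derivC; ring.
have -> : 2%:R * (('X - 1) * q^`()) + q =
   2%:R * ('X * q^`()) + q - 2%:R * q^`() by ring.
rewrite !(circle_meanD _ (_ - _)) !(circle_meanD _ _ (- _)).
rewrite !circle_meanN circle_mean_nat.
by ring: rel.
Qed.

(** The mean of (X - 1)^k is a constant times (X^2 - 1)^k.  The induction on k
    uses only the ratio of consecutive means, given by [circle_mean_rec1]. *)
Lemma deriv_circle_mean (F : fieldType) (charF0 : [pchar F] =i pred0) q :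
  ('X ^+ 2 - 1) * (circle_mean F q)^`() =
  2%:R * 'X * circle_mean F (('X - 1) * q^`()).
Proof.
elim/(@poly_lin_ind F 1): q => [|a p q IHp IHq|k].
- by rewrite circle_mean0 deriv0 !mulr0 circle_mean0 mulr0.
- rewrite derivD derivM derivC mul0r add0r.
  have -> : ('X - 1) * (a%:P * p^`() + q^`()) =
    a%:P * (('X - 1) * p^`()) + ('X - 1) * q^`() by ring.
  rewrite !circle_meanD !circle_meanC derivD derivM derivC mul0r add0r.
  by rewrite mulrDr (mulrCA _ a%:P) IHp IHq; ring.
rewrite polyC1; set Y := 'X - 1.
have dY : Y^`() = 1 by rewrite derivB derivX derivC subr0.
have YXn n : Y * (Y ^+ n)^`() = n%:R * Y ^+ n.
  rewrite deriv_exp dY mul1r -mulr_natl.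
  by case: n => [|n]; rewrite ?exprS /=; ring.
rewrite YXn circle_mean_nat; elim: k => [|k IH].
  by rewrite expr0 -(expr0 'X) circle_meanXn derivC; ring.
have step : k.+1%:R * circle_mean F (Y ^+ k.+1) =
    (2 * k + 1)%:R * (('X ^+ 2 - 1) * circle_mean F (Y ^+ k)).
  have := circle_mean_rec1 F charF0 (Y ^+ k).
  rewrite -/Y -exprS !YXn circle_meanD !circle_mean_nat => ->; ring.
have dstep := congr1 (@deriv F) step.
apply: (mulfI (pnatr_neq0 F charF0 k)).
rewrite !deriv_natl derivM derivB derivC derivXn /= in dstep.
rewrite subr0 expr1 -[_ *+ 2]mulr_natl in dstep.
rewrite [LHS]mulrCA dstep.
set v := _ - 1; set L := circle_mean F (Y ^+ k).
set L' := circle_mean F (Y ^+ k.+1).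
have -> : k.+1%:R * (2%:R * 'X * (k.+1%:R * L')) =
    2%:R * 'X * k.+1%:R * (k.+1%:R * L') by ring.
have -> : v * ((2 * k + 1)%:R * (2%:R * 'X * L + v * L^`())) =
    (2 * k + 1)%:R * (v * (2%:R * 'X * L) + v * (v * L^`())) by ring.
by rewrite step IH -/v -/L; ring.
Qed.

(** * Legendre's operator and its symmetric square *)

(** Legendre's equation of degree r is the vanishing of this operator for
    l = r (r + 1). *)
Definition legendre_op (F : fieldType) (l : {poly F}) (q : {poly F}) :=
  (('X ^+ 2 - 1) * q^`())^`() - l * q.

(** With w = 1 - X^2, this is (w (w q')')' + 4 l w q' + 2 l w' q, the operator
    that kills all products of two solutions of Legendre's equation. *)
Definition legendre_sym2_op (F : fieldType) (l : {poly F}) (q : {poly F}) :=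
  let w := 1 - 'X ^+ 2 in
  (w * (w * q^`())^`())^`() + 4%:R * l * (w * q^`()) - 4%:R * l * ('X * q).

Lemma deriv_1subX2 (F : fieldType) :
  (1 - 'X ^+ 2 : {poly F})^`() = - (2%:R * 'X).
Proof. by rewrite derivB derivC derivXn /= expr1 -mulr_natl sub0r. Qed.

(** Legendre's equation says z' = - l p for z = w p'.  Hence w (p^2)' = 2 p z
    and w (w (p^2)')' = 2 z^2 - 2 l w p^2, and one more derivative cancels the
    two remaining terms. *)
Lemma sym2_op_sqr (F : fieldType) (l : F) (p : {poly F}) :
  legendre_op F l%:P p = 0 -> legendre_sym2_op F l%:P (p ^+ 2) = 0.
Proof.
rewrite /legendre_op /legendre_sym2_op => ode.
set w := 1 - 'X ^+ 2.
set z := w * p^`().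
have dz : z^`() = - (l%:P * p).
  have -> : z = - (('X ^+ 2 - 1) * p^`()) by rewrite /z /w; ring.
  by rewrite derivN; congr (- _); apply/eqP; rewrite -subr_eq0 ode.
have -> : w * (p ^+ 2)^`() = 2%:R * (p * z).
  by rewrite expr2 derivM /z; ring.
have -> : w * (2%:R * (p * z))^`() = 2%:R * (z * z - l%:P * (w * (p * p))).
  by rewrite deriv_natl derivM dz /z; ring.
rewrite deriv_natl derivB derivM dz derivM derivC mul0r add0r.
rewrite derivM deriv_1subX2 derivM /z; ring.
Qed.

(** With v = X^2 - 1, [deriv_circle_mean] pushes a derivative multiplied by v
    inside the mean, and [circle_mean_rec1] absorbs a factor v.  The operator
    applied to the mean is thus again a mean, and its argument factors as
    2 th + 1 applied to Legendre's operator, where th = (X - 1) d/dX. *)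
Lemma sym2_op_circle_mean (F : fieldType) (charF0 : [pchar F] =i pred0)
    (l : F) q :
  legendre_sym2_op F l%:P (circle_mean F q) =
  4%:R * 'X * circle_mean F (2%:R * (('X - 1) * (legendre_op F l%:P q)^`())
                       + legendre_op F l%:P q).
Proof.
pose Y : {poly F} := 'X - 1; pose v : {poly F} := 'X ^+ 2 - 1.
pose th (f : {poly F}) := Y * f^`().
have dY : Y^`() = 1 by rewrite derivB derivX derivC subr0.
have v_neq0 : v != 0.
  by rewrite -size_poly_eq0 /v -polyC1 size_XnsubC.
have dL f : v * (circle_mean F f)^`() = 2%:R * 'X * circle_mean F (th f) :=
  deriv_circle_mean F charF0 f.
have YL f : circle_mean F (Y * (Y * f)^`()) =
    v * circle_mean F (2%:R * th f + f) :=
  circle_mean_rec1 F charF0 f.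
have wE : 1 - 'X ^+ 2 = - v by rewrite opprB.
(* [h] is twice Legendre's operator at eigenvalue 0, as X^2 - 1 = Y (Y + 2). *)
pose h := 2%:R * (th q + th (th q)) + 4%:R * (Y * q^`())^`().
have inner : v * (v * (circle_mean F q)^`())^`() = circle_mean F (Y * h).
  rewrite dL -mulrA deriv_natl derivM derivX.
  have -> : v * (2%:R * (1 * circle_mean F (th q)
        + 'X * (circle_mean F (th q))^`())) =
     2%:R * (v * circle_mean F (th q))
     + 2%:R * 'X * (v * (circle_mean F (th q))^`()) by ring.
  rewrite dL.
  have YLq := YL (th q).
  have -> : Y * h = 2%:R * (Y * (Y * th q)^`()) + 4%:R * th (th q).
    by rewrite /h /th !derivM dY; ring.
  move: YLq; rewrite !(circle_meanD, circle_mean_nat) => ->.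
  by rewrite /v; ring.
have outer : (circle_mean F (Y * h))^`() =
    2%:R * 'X * circle_mean F (2%:R * th h + h).
  by apply: (mulfI v_neq0); rewrite dL YL; ring.
have -> : legendre_sym2_op F l%:P (circle_mean F q) =
   (v * (v * (circle_mean F q)^`())^`())^`()
   - 4%:R * l%:P * (v * (circle_mean F q)^`())
   - 4%:R * l%:P * ('X * circle_mean F q).
  by rewrite /legendre_sym2_op wE !(mulNr, derivN, mulrN, opprK); ring.
have legE : 2%:R * legendre_op F l%:P q = h - 2%:R%:P * (l%:P * q).
  rewrite /legendre_op.
  have -> : 'X ^+ 2 - 1 = Y * (Y + 2%:R%:P) :> {poly F}.
    by rewrite /Y polyC_natr; ring.
  have dY2 : (Y + 2%:R%:P)^`() = 1 by rewrite derivD dY derivC addr0.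
  rewrite /h /th !(derivM, dY2, dY) polyC_natr; ring.
rewrite inner outer dL.
have -> : 4%:R * 'X *
    circle_mean F (2%:R * (('X - 1) * (legendre_op F l%:P q)^`())
             + legendre_op F l%:P q) =
  2%:R * 'X * circle_mean F (2%:R * th (2%:R * legendre_op F l%:P q)
             + 2%:R * legendre_op F l%:P q).
  rewrite /th.
  move: (legendre_op _ _ _) => f; rewrite deriv_natl [Y * _]mulrCA.
  rewrite (circle_meanD _ (_ * _)) (circle_meanD _ (_ * (_ * _))).
  by rewrite !circle_mean_nat; ring.
rewrite legE /th derivB !derivM !derivC !mul0r !add0r.
have -> : 2%:R * (Y * (h^`() - 2%:R%:P * (l%:P * q^`())))
    + (h - 2%:R%:P * (l%:P * q))
  = 2%:R * (Y * h^`()) + h - l%:P * (4%:R * (Y * q^`()) + 2%:R * q).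
  by rewrite polyC_natr; ring.
rewrite (circle_meanD _ _ (- _)) circle_meanN circle_meanC.
by rewrite !(circle_meanD, circle_mean_nat); ring.
Qed.

(** If q = g (X - 1)^n with g(1) nonzero, then w d/dX preserves this form and
    multiplies the value of the cofactor at 1 by -2n.  After multiplication of
    the equation by w, the third-order term is (w d/dX)^3 q, while the other
    terms have an extra factor X - 1.  So (-2n)^3 = 0, that is n = 0, and q(1)
    is nonzero. *)
Lemma sym2_op_uniq (F : fieldType) (charF0 : [pchar F] =i pred0) l q :
  legendre_sym2_op F l q = 0 -> q.[1] = 0 -> q = 0.
Proof.
move=> ode q1; apply/eqP/negPn/negP => nz.
have [n [g]] := multiplicity_XsubC q 1.
rewrite nz /= => g1 qE.
set w : {poly F} := 1 - 'X ^+ 2.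
pose h (f : {poly F}) := - ('X + 1) * (n%:R * f + ('X - 1%:P) * f^`()).
have hE f : w * (f * ('X - 1%:P) ^+ n)^`() = h f * ('X - 1%:P) ^+ n.
  rewrite derivM deriv_exp derivB derivX derivC subr0 mul1r -mulr_natl /h /w.
  by case: n {qE h} => [|n]; rewrite ?exprS /= polyC1; ring.
have h1 f : (h f).[1] = - (2 * n)%:R * f.[1].
  rewrite /h mulr_natl !(hornerM, hornerN, hornerD, hornerMn, hornerX, hornerC).
  by rewrite subrr; ring.
have : w * legendre_sym2_op F l q =
   (h (h (h g)) - ('X - 1%:P) * (4%:R * l * (('X + 1) * (h g - 'X * g))))
    * ('X - 1%:P) ^+ n.
  rewrite /legendre_sym2_op -/w qE !hE mulrBr mulrDr hE /w polyC1; ring.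
rewrite ode mulr0 => /esym/eqP.
rewrite mulf_eq0 expf_eq0 polyXsubC_eq0 andbF orbF.
move=> /eqP/subr0_eq hhh.
have : (h (h (h g))).[1] = 0 by rewrite hhh hornerM hornerXsubC subrr mul0r.
rewrite !h1 => /eqP; rewrite !mulf_eq0 (negbTE (g1 : g.[1] != 0)) orbF.
rewrite oppr_eq0 !orbb; move/pcharf0P: charF0 => ->.
rewrite muln_eq0 /= => /eqP n0.
move: q1; rewrite qE n0 expr0 mulr1 => /eqP.
by rewrite (negbTE (g1 : g.[1] != 0)).
Qed.

Lemma circle_mean_legendre (F : fieldType) (charF0 : [pchar F] =i pred0) r :
  circle_mean F (legendre F r) = legendre F r ^+ 2.
Proof.
have op0 : legendre_op F (r * r.+1)%:R%:P (legendre F r) = 0.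
  by rewrite /legendre_op legendre_ode // polyC_natr subrr.
apply/eqP; rewrite -subr_eq0; apply/eqP.
apply: (sym2_op_uniq F charF0 (r * r.+1)%:R%:P); last first.
  by rewrite !hornerE horner_circle_mean1 // horner_legendre1 // expr1n subrr.
have symB p q : legendre_sym2_op F (r * r.+1)%:R%:P (p - q) =
   legendre_sym2_op F (r * r.+1)%:R%:P p
   - legendre_sym2_op F (r * r.+1)%:R%:P q.
  by rewrite /legendre_sym2_op !(derivB, mulrBr); ring.
rewrite symB sym2_op_sqr // sym2_op_circle_mean // op0.
by rewrite derivC !mulr0 addr0 circle_mean0 mulr0 subr0.
Qed.

Theorem mainTheorem5 (F : fieldType) (charF0 : [pchar F] =i pred0) (r : nat) :
  exists T : nat -> {poly F},
    (forall i : nat, is_sqrt_legendre i (T i)) /\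
    legendre F r ^+ 2 =
      \sum_(i < r.+1 | odd i == odd r) (legendre F r)`_i *: T i.
Proof.
exists (sqrt_legendre F); split; first exact: sqrt_legendreP.
rewrite -circle_mean_legendre //.
rewrite (@circle_mean_widen F _ r.+1) ?size_legendre //.
rewrite [RHS]big_mkcond; apply: eq_bigr => i _; case: ifPn => // par.
by rewrite legendre_coef_parity ?scale0r.
Qed.
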